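(* Let $(a(p))_{p\ge1}$ be any sequence of positive real numbers. Then one can find a sequence $(A(p))_{p\ge1}$ of pairwise disjoint subsets of $\mathbb N$ such that (i) each set $A(p)$ has positive lower density; (ii) $\min A(p)\ge a(p)$ for all $p$, and $|n-n'|\ge a(p)+a(q)$ whenever $n\ne n'$ and $(n,n')\in A(p)\times A(q)$ (for all $p,q\ge1$, including $p=q$); (iii) for all $C>0$, there exists $\kappa>0$ such that, for all $p\ne q$ and all $(n,n')\in A(p)\times A(q)$ with $\max(n,n')\ge\kappa$, one has $|n-n'|\ge C$.
   Context: $\mathbb N=\{1,2,\dots\}$. The lower density of $A\subset\mathbb N$ is $\liminf_{N\to\infty}\frac1N\mathrm{card}(A\cap[1,N])$. *)

(* Defs.v *)
From HB Require Import structures.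
From mathcomp Require Import all_boot all_order all_algebra finmap.
From mathcomp Require Import all_classical all_reals all_analysis.
Set Implicit Arguments.
Unset Strict Implicit.
Unset Printing Implicit Defensive.

Import Order.TTheory GRing.Theory Num.Theory.
Local Open Scope classical_set_scope.
Local Open Scope ring_scope.

(* The positive integers, as a subset of [nat] (which contains 0). *)
Definition posN : set nat := [set n | (1 <= n)%N].

(* [fset_set] is the finite set underlying a (finite) classical set.  The term
   of index N = 0 is 0 / 0 = 0 and plays no role in the limit inferior. *)
Definition lower_density (R : realType) (A : set nat) : \bar R :=
  limn_einf (fun N : nat =>
    ((#|` fset_set (A `&` [set n | (1 <= n <= N)%N])|%fset)%:R / N%:R : R)%:E).

Definition is_min (A : set nat) (m : nat) : Prop := A m /\ lbound A m.

(* Main.v *)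
(** Fix a nondecreasing [c] with [2 a(p) <= 2^(c p)].  In the dyadic block from
    [2^k] to [2^(k+1)], where [k = p + m + 1], the set [A(p)] is an arithmetic
    progression of step [2^(c p)] filling the window of length [2^m] that starts
    at [2^k + 2^(m+1)].  The window is a fixed proportion of the block, whence
    the positive lower density.  Above it lies a gap of length at least [2^m],
    so two windows of one block are separated by the length of the lower one,
    and two windows of different blocks by the sum of both lengths.  Starting
    [A(p)] only at [m >= c p + p] makes these lengths at least [2^(c p)] and, as
    then [k <= 2 m + 1], at least of the order of the square root of the points
    of the block, uniformly in [p]. *)
Require Import Defs.
From HB Require Import structures.
From mathcomp Require Import all_boot all_order all_algebra finmap.
From mathcomp Require Import all_classical all_reals all_analysis.
From mathcomp Require Import zify lra.
Set Implicit Arguments.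
Unset Strict Implicit.
Unset Printing Implicit Defensive.

Import Order.TTheory GRing.Theory Num.Theory.
Local Open Scope classical_set_scope.
Local Open Scope ring_scope.

Section SeparatedSets.
Local Open Scope nat_scope.
Implicit Types (c : nat -> nat) (p q m j n : nat).

Definition block_pt c p m j : nat :=
  2 ^ (p + m).+1 + 2 ^ m.+1 + 2 ^ c p * j.

Definition sep_set c p : set nat := [set n | exists m j,
  [/\ c p + p <= m, j < 2 ^ (m - c p) & n = block_pt c p m j]].

Lemma block_pt_bounds c p m j : c p <= m -> j < 2 ^ (m - c p) ->
  2 ^ (p + m).+1 + 2 ^ m.+1 <= block_pt c p m j
    < 2 ^ (p + m).+1 + 2 ^ m.+1 + 2 ^ m.
Proof.
move=> cm jm; rewrite /block_pt leq_addr ltn_add2l /=.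
by rewrite -[X in _ < 2 ^ X](subnKC cm) expnD ltn_pmul2l ?expn_gt0.
Qed.

(** With [k = p + m + 1], the window ends at [2^k + 3 * 2^m]; another [2^m] reaches [2^k + 2^(m+2)],
    at most [2^(k+1)] because [p >= 1]. *)
Lemma block_pt_lt c p m j : 0 < p -> c p <= m -> j < 2 ^ (m - c p) ->
  block_pt c p m j + 2 ^ m <= 2 ^ (p + m).+2.
Proof.
move=> p0 cm jm; have /andP[_] := block_pt_bounds cm jm.
have : 2 ^ m.+2 <= 2 ^ (p + m).+1 by apply: leq_pexp2l => //; lia.
by rewrite !expnS; lia.
Qed.

(** The factor 2 matches the normalisation [2 a(p) <= 2^(c p)]. The quadratic bound yields (iii),
    and also disjointness, since it fails at [n = n']. *)
Lemma sep_set_gap c p q n n' : {homo c : i k / i <= k} ->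
  0 < p -> 0 < q -> p <> q -> sep_set c p n -> sep_set c q n' -> n <= n' ->
  2 ^ c p + 2 ^ c q <= 2 * (n' - n) /\ n' < 4 * (n' - n) ^ 2.
Proof.
move=> c_mono p0 q0 pq [m [j [cm jm ->]]] [m' [j' [cm' jm' ->]]].
have cpm : c p <= m by lia.
have cqm : c q <= m' by lia.
have /andP[xl xu] := block_pt_bounds cpm jm.
have /andP[yl yu] := block_pt_bounds cqm jm'.
have x_lt := block_pt_lt p0 cpm jm.
have y_lt := block_pt_lt q0 cqm jm'.
move: (block_pt c p m j) (block_pt c q m' j') => x y in xl xu yl yu x_lt y_lt *.
move=> xy.
have pow_le i k : i <= k -> 2 ^ i <= 2 ^ k by apply: leq_pexp2l.
have pow_gt0 i : 0 < 2 ^ i by rewrite expn_gt0.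
have cpm2 := pow_le _ _ cpm.
have cqm2 := pow_le _ _ cqm.
(* As [y < 2^(q+m'+2)], a gap [2^i] with [q + m' <= 2 i] suffices. *)
have square_lt i : q + m' <= 2 * i -> 2 ^ i <= y - x -> y < 4 * (y - x) ^ 2.
  move=> qmi ixy; apply: (@leq_trans (4 * (2 ^ i) ^ 2)).
    rewrite -expnM -(expnD 2 2).
    by have := pow_gt0 m'; have := pow_le (q + m').+2 (2 + i * 2); lia.
  by rewrite leq_mul2l leq_exp2r.
have [kk|kk|kk] := ltngtP (p + m) (q + m').
(* Here [x] lies in a lower block: the gap above its window gives [2^m], the offset of [y] in its
   own block gives more than [2^m']. *)
- have kpow := pow_le (p + m).+2 (q + m').+1 kk.
  have d : 2 ^ m + 2 ^ m' <= y - x.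
    by rewrite !expnS in kpow yl x_lt *; lia.
  split; first by lia.
  by apply: (square_lt m'); lia.
- by have := pow_le (q + m').+2 (p + m).+1 kk; have := pow_gt0 m'; lia.
(* In a common block the smaller index has the larger [m], hence the higher window; so [p < q] would
   contradict [x <= y]. *)
- have [pltq|qltp|//] := ltngtP p q.
    have := pow_le m'.+2 m.+1; rewrite kk in xl; have := pow_gt0 m'.
    by rewrite !expnS in xl yu *; lia.
  have mpow := pow_le m.+2 m'.+1.
  have d : 2 ^ m <= y - x.
    by rewrite kk in xu; rewrite !expnS in xu yl mpow; lia.
  split; last by apply: (square_lt m); lia.
  (* Only the length [2^m] of the lower window is available; monotonicity gives [c q <= c p <= m],
     so it dominates both powers. *)
  by have := pow_le _ _ (c_mono _ _ (ltnW qltp)); lia.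
Qed.

(** Every point of the set is a multiple of [2^(c p)], across all blocks. *)
Lemma sep_set_self_gap c p n n' :
  sep_set c p n -> sep_set c p n' -> n < n' -> 2 ^ c p <= n' - n.
Proof.
move=> [m [j [cm jm ->]]] [m' [j' [cm' jm' ->]]] nn'.
have dv i k : c p <= i -> 2 ^ c p %| block_pt c p i k.
  move=> ci; rewrite /block_pt !dvdn_add ?dvdn_mulr ?dvdn_exp2l //; lia.
by apply: dvdn_leq; rewrite ?subn_gt0// dvdn_sub// dv//; lia.
Qed.

Lemma is_min_sep_set c p : is_min (sep_set c p) (block_pt c p (c p + p) 0).
Proof.
split; first by exists (c p + p), 0; rewrite expn_gt0.
move=> _ [m [j [cm _ ->]]]; rewrite leEnat /block_pt muln0 addn0.
by rewrite -[leqLHS]addn0 !leq_add// leq_pexp2l//; lia.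
Qed.

Lemma expn_le_block_pt c p m j : c p <= m -> 2 ^ c p <= block_pt c p m j.
Proof.
move=> cm; rewrite /block_pt.
by have : 2 ^ c p <= 2 ^ m.+1; [apply: leq_pexp2l => //; lia | lia].
Qed.

Lemma sep_set_count c p N : 0 < p -> 2 ^ (c p + 2 * p + 2) <= N ->
  N <= 2 ^ (c p + p + 3) *
       #|` fset_set (sep_set c p `&` [set n | (1 <= n <= N)%N]) |%fset.
Proof.
move=> p0 N_ge.
have N0 : 0 < N by apply: leq_trans N_ge; rewrite expn_gt0.
set K := trunc_log 2 N.
have K_ge : c p + 2 * p + 2 <= K by apply: trunc_log_max.
have NK : 2 ^ K <= N by apply: trunc_logP.
have KN : N < 2 ^ K.+1 by apply: trunc_log_ltn.
(* This block ends at [2^K <= N], so its whole window of [2^(m - c p)] points is counted; multiplied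
   by [2^(c p + p + 3)] this is [2^(K+1) > N]. *)
pose m := K - (p + 2).
have cm : c p + p <= m by rewrite /m; lia.
have cpm : c p <= m by lia.
have Km : K = (p + m).+2 by rewrite /m; lia.
pose F := [fset block_pt c p m (i : 'I_(2 ^ (m - c p))) | i in 'I__]%fset.
have F_card : #|` F|%fset = 2 ^ (m - c p).
  rewrite card_imfset ?size_enum_ord// => i k /eqP.
  by rewrite /block_pt eqn_add2l eqn_pmul2l ?expn_gt0// => /eqP/val_inj.
apply: (@leq_trans (2 ^ (c p + p + 3) * #|` F|%fset)).
  rewrite F_card -expnD; have -> : c p + p + 3 + (m - c p) = K.+1 by lia.
  exact: ltnW.
rewrite leq_mul2l fsubset_leq_card ?orbT//.
have fin : finite_set (sep_set c p `&` [set n | (1 <= n <= N)%N]).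
  by apply: (sub_finite_set _ (finite_II N.+1)) => n [_ /andP[]].
apply/fsubsetP => _ /imfsetP[i _ ->].
rewrite in_fset_set// inE; split; first by exists m, i.
have := block_pt_lt p0 cpm (ltn_ord i); rewrite -Km => le_K.
have := expn_le_block_pt i cpm; have : 0 < 2 ^ c p by rewrite expn_gt0.
by move=> /=; lia.
Qed.

End SeparatedSets.

Lemma limn_einf_ge (R : realType) (u : (\bar R)^nat) (x : \bar R) (N0 : nat) :
  (forall n, (N0 <= n)%N -> (x <= u n)%E) -> (x <= limn_einf u)%E.
Proof.
move=> xu; rewrite limn_einf_lim; apply: lime_ge; first exact: is_cvg_einfs.
exists N0 => // n /= N0n; apply: le_ereal_inf_tmp => _ [k /= nk <-].
by apply: xu; exact: leq_trans nk.
Qed.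

Lemma lower_density_sep_set_gt0 (R : realType) (c : nat -> nat) (p : nat) :
  (0 < p)%N -> (0 < lower_density R (sep_set c p))%E.
Proof.
move=> p0; set e : R := (2 ^ (c p + p + 3))%:R.
have e0 : 0 < e by rewrite ltr0n expn_gt0.
apply: (@lt_le_trans _ _ (e^-1)%:E); first by rewrite lte_fin invr_gt0.
apply: (@limn_einf_ge _ _ _ (2 ^ (c p + 2 * p + 2))%N) => N N_ge.
have N0 : 0 < N%:R :> R by rewrite ltr0n (leq_trans _ N_ge)// expn_gt0.
by rewrite lee_fin ler_pdivlMr// ler_pdivrMl// -natrM ler_nat sep_set_count.
Qed.

Lemma homo_expn_bound (R : realType) (b : nat -> R) :
  exists2 c : nat -> nat, {homo c : p q / (p <= q)%N} &
    forall p, b p <= (2 ^ c p)%:R.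
Proof.
(* Partial sums of positive integers are monotone, and the last term already exceeds [b p]. *)
exists (fun p => \sum_(0 <= i < p.+1) (Num.truncn (b i)).+1)%N => [p q pq|p].
  by rewrite [leqRHS](big_cat_nat _ (n := p.+1))//= leq_addr.
apply: (le_trans (ltW (truncnS_gt (b p)))); rewrite ler_nat.
rewrite (leq_trans _ (ltnW (ltn_expl _ _)))// big_nat_recr//=.
exact: leq_addl.
Qed.

Theorem theorem5p15 (R : realType) (a : nat -> R)
    (a_gt0 : forall p : nat, posN p -> 0 < a p) :
  exists A : nat -> set nat,
    [/\ (forall p : nat, posN p -> A p `<=` posN),
        trivIset posN A,
        (forall p : nat, posN p -> (0 < lower_density R (A p))%E),
        (forall p : nat, posN p -> exists m : nat, is_min (A p) m /\ a p <= m%:R)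
        /\ (forall p q : nat, posN p -> posN q ->
              forall n n' : nat, n <> n' -> A p n -> A q n' ->
                a p + a q <= `|n%:R - n'%:R|)
      & (forall C : R, 0 < C -> exists kappa : R, 0 < kappa /\
           forall p q : nat, posN p -> posN q -> p <> q ->
           forall n n' : nat, A p n -> A q n' ->
             kappa <= (maxn n n')%:R -> C <= `|n%:R - n'%:R|)].
Proof.
have [c c_mono c_ge] := homo_expn_bound (fun p => 2 * a p).
have distE (n n' : nat) : (n <= n')%N -> `|n%:R - n'%:R| = (n' - n)%:R :> R.
  by move=> nn'; rewrite distrC -natrB// normr_nat.
exists (sep_set c); split.
- move=> p _ n [m [j [_ _ ->]]]; rewrite /posN /= /block_pt.
  by rewrite !addn_gt0 expn_gt0.
- move=> p q p0 q0 [n [pn qn]]; apply: contrapT => pq.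
  by have [_] := sep_set_gap c_mono p0 q0 pq pn qn (leqnn n); rewrite subnn.
- by move=> p p0; exact: lower_density_sep_set_gt0.
- split=> [p p0|p q p0 q0].
    exists (block_pt c p (c p + p) 0); split; first exact: is_min_sep_set.
    have := expn_le_block_pt 0 (leq_addr p (c p)).
    by rewrite -(ler_nat R) => ?; have := c_ge p; have := a_gt0 p p0; lra.
  move=> n n'; wlog nn' : p q n n' p0 q0 / (n <= n')%N => [wlg nN pn qn|nN pn qn].
    have [nn'|nn'] := orP (leq_total n n'); first exact: wlg.
    by rewrite [_ + a q]addrC distrC; apply: wlg => //; exact: nesym.
  rewrite distE//; suff : (2 ^ c p + 2 ^ c q <= 2 * (n' - n))%N.
    rewrite -(ler_nat R) natrD natrM.
    by have := c_ge p; have := c_ge q; lra.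
  have [pq|/eqP pq] := eqVneq p q; last first.
    by have [] := sep_set_gap c_mono p0 q0 pq pn qn nn'.
  rewrite -pq in qn *; rewrite addnn -mul2n leq_mul2l /=.
  by apply: (sep_set_self_gap pn qn); rewrite ltn_neqAle nn' andbT; apply/eqP.
(* From [4 C^2 <= n' < 4 (n' - n)^2] one gets [C < n' - n]. *)
- move=> C C0; exists (4 * C ^+ 2); split; first by rewrite mulr_gt0// exprn_gt0.
  move=> p q p0 q0 pq n n'.
  wlog nn' : p q n n' p0 q0 pq / (n <= n')%N => [wlg pn qn|pn qn].
    have [nn'|nn'] := orP (leq_total n n'); first exact: wlg pn qn.
    by rewrite maxnC distrC; apply: (wlg q p) => //; exact: nesym.
  rewrite (maxn_idPr nn') distE// => Cn'.
  have [_] := sep_set_gap c_mono p0 q0 pq pn qn nn'.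
  rewrite -(ltr_nat R) natrM natrX => n'_lt.
  rewrite -(@ler_pXn2r _ 2)// ?nnegrE ?ler0n// ?(ltW C0)//.
  by have := le_lt_trans Cn' n'_lt; lra.
Qed.
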